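(* Up to isometry, there are at least $246896$ sets of $57$ equiangular lines in dimension $18$ (i.e. in $\mathbb{R}^{18}$) with common angle $\arccos(1/5)$.
   Context: A set of lines through the origin in a real Euclidean space is equiangular with common angle $\theta$ if any two distinct lines in it form the angle $\theta$. For a set $\Phi$ of equiangular lines, $\langle\Phi\rangle_{\mathbb{R}}$ is the smallest vector subspace containing all lines of $\Phi$. Two sets $\Phi,\Phi'$ of equiangular lines are isometric if there is a linear (inner-product-preserving) isometry $f:\langle\Phi\rangle_{\mathbb{R}}\to\langle\Phi'\rangle_{\mathbb{R}}$ with $f(\Phi)=\Phi'$, where $f(\Phi)=\{f(l):l\in\Phi\}$. *)

(* Defs.v *)
From HB Require Import structures.
From mathcomp Require Import all_boot all_order all_algebra.
From mathcomp Require Import finmap.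
From mathcomp Require Import reals trigo.

Set Implicit Arguments.
Unset Strict Implicit.
Unset Printing Implicit Defensive.

Import Order.TTheory GRing.Theory Num.Theory.

Local Open Scope ring_scope.
Local Open Scope fset_scope.

Section EquiangularLines.
Variables (R : realType) (d : nat).

Definition dot (u v : 'rV[R]_d) : R := \sum_(i < d) u 0 i * v 0 i.

(* The norm that the library puts on matrices is the sup norm. *)
Definition enorm (u : 'rV[R]_d) : R := Num.sqrt (dot u u).

(* The absolute value makes this the angle, in [0, pi/2], between the lines
   spanned by u and v; it does not depend on the spanning vectors. *)
Definition line_angle (u v : 'rV[R]_d) : R :=
  acos (`|dot u v| / (enorm u * enorm v)).

(* Lines through the origin are the subspaces of dimension 1. Equiangular sets
   of lines in R^d are finite, so finite sets lose no generality. *)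
Definition equiangular (theta : R) (Phi : {fset {vspace 'rV[R]_d}}) : Prop :=
  (forall l, l \in Phi -> \dim l = 1%N) /\
  (forall l m, l \in Phi -> m \in Phi -> l != m ->
   forall u v, u \in l -> v \in m -> u != 0 -> v != 0 ->
     line_angle u v = theta).

Definition fspan (Phi : {fset {vspace 'rV[R]_d}}) : {vspace 'rV[R]_d} :=
  (\sum_(l <- Phi) l)%VS.

(* For l included in U, the preimage of l under the inclusion of U is l seen as
   a subspace of U. *)
Definition line_image (U V : {vspace 'rV[R]_d})
    (f : 'Hom(subvs_of U, subvs_of V)) (l : {vspace 'rV[R]_d}) :
    {vspace 'rV[R]_d} :=
  (linfun vsval @: (f @: (linfun vsval @^-1: l)))%VS.

(* Such an f is injective because it preserves dot, and onto because the image
   of Phi is Phi'. *)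
Definition isometric (Phi Phi' : {fset {vspace 'rV[R]_d}}) : Prop :=
  exists f : 'Hom(subvs_of (fspan Phi), subvs_of (fspan Phi')),
    (forall x y, dot (vsval (f x)) (vsval (f y)) = dot (vsval x) (vsval y)) /\
    [fset line_image f l | l in Phi] = Phi'.

End EquiangularLines.

(* Main.v *)
Require Import Defs.
From HB Require Import structures.
From Stdlib Require Import ZArith.
From mathcomp Require Import all_boot all_order all_algebra.
From mathcomp Require Import all_fingroup.
From mathcomp Require Import finmap.
From mathcomp Require Import ssrZ zify ring lra.
From mathcomp Require Import reals trigo.

(**
  Take w_0, ..., w_9 in R^9 with w_i.w_j = [i = j] - 1/10.  In R^18 = R^9 + R^9
  there are two kinds of vectors of norm 5/2: (w_i, w_a + w_b) for a point i and
  an edge {a, b} of K_10, and (sum of w_i for i in S, 0) for a 5-subset S.  Their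
  mutual inner products are +-1/2 if the edges carrying a given i form a matching,
  each edge is used once, and the 5-subsets meet in 2 or 3 points.  So
  a one-factorization of K_10, a bijection from its nine factors to nine of the ten
  points and a family of twelve 5-subsets give 45 + 12 = 57 lines.  The family
  of 5-subsets is fixed; we vary the bijection, and use two one-factorizations.

  An isometry between two such sets is a bijection of the lines preserving twice
  the Gram matrix g up to switching.  The diagonal of g^3 separates edge lines from
  block lines; the signs of an edge line against the block lines determine its
  factor; the factors are told apart by a sum of cubed triangle counts, which also
  separates the two one-factorizations.  What remains is a permutation of the ten
  points that preserves the sums over the blocks of products of four incidence
  signs, and there are at most 24 of these (the rotations of a cube, acting on
  6 faces and 4 diagonals).  Hence there are at least 2 * 10! / 24 = 302400
  isometry classes.
*)

Set Implicit Arguments.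
Unset Strict Implicit.
Unset Printing Implicit Defensive.

Import Order.TTheory GRing.Theory Num.Theory.

Local Open Scope ring_scope.

(** * Computable sums and bounded checks, and the combinatorial data *)

(** Big operators are locked; sums in this form are evaluated by [vm_compute]. *)
Definition Zsum (n : nat) (F : nat -> Z) : Z :=
  foldr (fun i a => F i + a) 0 (iota 0 n).

Lemma ZsumE n (F : nat -> Z) : \sum_(i < n) F i = Zsum n F.
Proof.
rewrite -(big_mkord xpredT F) /index_iota subn0 /Zsum.
by elim: (iota 0 n) => [|i s IH]; rewrite ?big_nil // big_cons IH.
Qed.

Definition all_lt (n : nat) (p : pred nat) : bool := all p (iota 0 n).

Lemma all_ltP n (p : pred nat) (i : 'I_n) : all_lt n p -> p i.
Proof. by move/allP; apply; rewrite mem_iota ltn_ord. Qed.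

(* Two one-factorizations of K_10 found by computer search, such that the 18
   colour invariants below are pairwise distinct. *)
Definition factors (b : bool) : seq (seq (seq nat)) := if b then
  [:: [:: [:: 0; 8]; [:: 1; 6]; [:: 2; 5]; [:: 3; 7]; [:: 4; 9]];
      [:: [:: 0; 9]; [:: 1; 2]; [:: 3; 4]; [:: 5; 6]; [:: 7; 8]];
      [:: [:: 0; 6]; [:: 1; 7]; [:: 2; 3]; [:: 4; 5]; [:: 8; 9]];
      [:: [:: 0; 7]; [:: 1; 4]; [:: 2; 6]; [:: 3; 8]; [:: 5; 9]];
      [:: [:: 0; 5]; [:: 1; 8]; [:: 2; 4]; [:: 3; 9]; [:: 6; 7]];
      [:: [:: 0; 2]; [:: 1; 3]; [:: 4; 8]; [:: 5; 7]; [:: 6; 9]];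
      [:: [:: 0; 1]; [:: 2; 9]; [:: 3; 5]; [:: 4; 7]; [:: 6; 8]];
      [:: [:: 0; 4]; [:: 1; 5]; [:: 2; 8]; [:: 3; 6]; [:: 7; 9]];
      [:: [:: 0; 3]; [:: 1; 9]; [:: 2; 7]; [:: 4; 6]; [:: 5; 8]]]%N
  else
  [:: [:: [:: 0; 5]; [:: 1; 6]; [:: 2; 8]; [:: 3; 9]; [:: 4; 7]];
      [:: [:: 0; 6]; [:: 1; 5]; [:: 2; 3]; [:: 4; 9]; [:: 7; 8]];
      [:: [:: 0; 2]; [:: 1; 4]; [:: 3; 6]; [:: 5; 8]; [:: 7; 9]];
      [:: [:: 0; 8]; [:: 1; 9]; [:: 2; 5]; [:: 3; 7]; [:: 4; 6]];
      [:: [:: 0; 7]; [:: 1; 8]; [:: 2; 4]; [:: 3; 5]; [:: 6; 9]];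
      [:: [:: 0; 4]; [:: 1; 3]; [:: 2; 6]; [:: 5; 7]; [:: 8; 9]];
      [:: [:: 0; 9]; [:: 1; 2]; [:: 3; 8]; [:: 4; 5]; [:: 6; 7]];
      [:: [:: 0; 1]; [:: 2; 7]; [:: 3; 4]; [:: 5; 9]; [:: 6; 8]];
      [:: [:: 0; 3]; [:: 1; 7]; [:: 2; 9]; [:: 4; 8]; [:: 5; 6]]]%N.

(* A block and its complement span the same line; the one containing 9 is listed. *)
Definition blocks : seq (seq nat) :=
  [:: [:: 1; 3; 7; 8; 9]; [:: 2; 5; 7; 8; 9]; [:: 1; 5; 6; 7; 9];
      [:: 1; 4; 6; 8; 9]; [:: 0; 2; 6; 8; 9]; [:: 3; 5; 6; 8; 9];
      [:: 0; 1; 2; 5; 9]; [:: 0; 3; 4; 5; 9]; [:: 0; 4; 7; 8; 9];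
      [:: 2; 4; 6; 7; 9]; [:: 0; 3; 6; 7; 9]; [:: 1; 2; 3; 4; 9]]%N.

(** * The Gram matrix of the lines and the sums entering its invariants *)

Definition edge b i k : seq nat := nth [::] (nth [::] (factors b) i) k.
Definition block s : seq nat := nth [::] blocks s.
Definition common (p q : seq nat) : nat := count [in q] p.

(* Twice the inner products. As 2 w_i.w_j = 2 [i = j] - 1/5, the sizes of the
   supports contribute the constants -1 and -5. *)
Definition edge_gram b (i k j l : nat) : Z :=
  2 * (i == j)%:R + 2 * (common (edge b i k) (edge b j l))%:R - 1.
Definition incidence (p s : nat) : Z := if p \in block s then 1 else -1.
Definition block_gram (s t : nat) : Z := 2 * (common (block s) (block t))%:R - 5.

Local Notation line := ('I_9 * 'I_5 + 'I_12)%type.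
(* The factors are placed at the points [f (point i)]; [f ord_max] is left free. *)
Definition point (i : 'I_9) : 'I_10 := widen_ord (leqnSn 9) i.

Definition gram b (f : {perm 'I_10}) (k l : line) : Z :=
  match k, l with
  | inl x, inl y => edge_gram b x.1 x.2 y.1 y.2
  | inl x, inr s => incidence (f (point x.1)) s
  | inr s, inl x => incidence (f (point x.1)) s
  | inr s, inr t => block_gram s t
  end.

Definition row_gram (p q : nat) : Z := Zsum 12 (fun s => incidence p s * incidence q s).
(** The even degree makes this sum insensitive to changing the sign of a block or of all points
    together. *)
Definition quad (p q r t : nat) : Z :=
  Zsum 12 (fun s => incidence p s * incidence q s * (incidence r s * incidence t s)).
(** Weighted closed walks of length three from an edge line through two further edge lines;
    [block_form] is its analogue through two block lines. *)
Definition edge_cube b i k : Z := Zsum 9 (fun j => Zsum 5 (fun l => edge_gram b i k j l *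
  Zsum 9 (fun j' => Zsum 5 (fun l' => edge_gram b j l j' l' * edge_gram b j' l' i k)))).
Definition block_form p : Z := Zsum 12 (fun s => incidence p s *
  Zsum 12 (fun t => block_gram s t * incidence p t)).
(** Here [u] is the point without a factor. The constant 445, the doubled sum and the last sum are
    the walks whose other two lines include two, one and no edge lines. *)
Definition block_cube u s : Z := (445 + 2 * Zsum 12 (fun t =>
    5 * (2 * block_gram s t - incidence u s * incidence u t) * block_gram t s)
  + Zsum 12 (fun t => block_gram s t *
      Zsum 12 (fun t' => block_gram t t' * block_gram t' s)))%R.

(** * Row sums and symmetry of the Gram matrix *)

(** The five edges of a factor cover each point once, so they share two points in all with any given
    edge. *)
Lemma edge_gram_factor b (i j : 'I_9) (k : 'I_5) :
  \sum_(l < 5) edge_gram b i k j l = 10 * (i == j)%:R - 1.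
Proof.
have H d : all_lt 9 (fun i => all_lt 5 (fun k => all_lt 9 (fun j =>
    Zsum 5 (edge_gram d i k j) == 10 * (i == j)%:R - 1))) by case: d; vm_compute.
rewrite (ZsumE 5 (edge_gram b i k j)); apply/eqP.
exact: (all_ltP j (all_ltP k (all_ltP i (H b)))).
Qed.

(** Each block holds exactly half of the ten points. *)
Lemma incidence_sum (s : 'I_12) : \sum_(p < 10) incidence p s = 0.
Proof.
have H : all_lt 12 (fun s => Zsum 10 (incidence ^~ s) == 0) by vm_compute.
by rewrite (ZsumE 10 (incidence ^~ s)); apply/eqP; exact: (all_ltP s H).
Qed.

Lemma incidence_sqr p s : incidence p s * incidence p s = 1.
Proof. by rewrite /incidence; case: ifP. Qed.

(** Two 5-subsets with c common points disagree on 10 - 2c points, which gives 4c - 10. *)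
Lemma incidence_block_gram (s t : 'I_12) :
  \sum_(p < 10) incidence p s * incidence p t = 2 * block_gram s t.
Proof.
have H : all_lt 12 (fun s => all_lt 12 (fun t =>
    Zsum 10 (fun p => incidence p s * incidence p t) == 2 * block_gram s t)).
  by vm_compute.
rewrite (ZsumE 10 (fun p => incidence p s * incidence p t)); apply/eqP.
exact: (all_ltP t (all_ltP s H)).
Qed.

Lemma edge_gram_sym b (i j : 'I_9) (k l : 'I_5) :
  edge_gram b i k j l = edge_gram b j l i k.
Proof.
have H d : all_lt 9 (fun i => all_lt 5 (fun k => all_lt 9 (fun j =>
    all_lt 5 (fun l => edge_gram d i k j l == edge_gram d j l i k)))).
  by case: d; vm_compute.
by apply/eqP; exact: (all_ltP l (all_ltP j (all_ltP k (all_ltP i (H b))))).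
Qed.

Lemma block_gram_sym (s t : 'I_12) : block_gram s t = block_gram t s.
Proof.
apply: (@mulfI _ (2 : Z)) => //; rewrite -!incidence_block_gram.
by apply: eq_bigr => p _; rewrite mulrC.
Qed.

Lemma gram_sym b f k l : gram b f k l = gram b f l k.
Proof.
case: k l => [[i k]|s] [[j l]|t] //=; first exact: edge_gram_sym.
exact: block_gram_sym.
Qed.

Section Perm.
Variables (f : {perm 'I_10}).

Lemma sum_perm_pt (F : 'I_10 -> Z) :
  \sum_(i < 9) F (f (point i)) = \sum_p F p - F (f ord_max).
Proof.
rewrite (reindex_inj (@perm_inj _ f)) [X in X - _]big_ord_recr /=.
by rewrite addrK.
Qed.

Lemma sum_incidence_pt (s : 'I_12) :
  \sum_(i < 9) incidence (f (point i)) s = - incidence (f ord_max) s.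
Proof. by rewrite (sum_perm_pt (fun p => incidence p s)) incidence_sum add0r. Qed.

(** Incidence is constant along a factor, so only the row sums [10 * [i = j] - 1] matter. The -1
    produces the incidence of the free point, because a block's ten signs sum to zero. *)
Lemma edge_gram_incidence b (i : 'I_9) (k : 'I_5) (s : 'I_12) :
  \sum_(j < 9) \sum_(l < 5) edge_gram b i k j l * incidence (f (point j)) s =
  incidence (f ord_max) s + 10 * incidence (f (point i)) s.
Proof.
under eq_bigr => j _ do rewrite -mulr_suml edge_gram_factor mulrBl mul1r.
rewrite sumrB sum_incidence_pt opprK addrC; congr (_ + _).
rewrite (bigD1 i) //= eqxx mulr1 big1 ?addr0 // => j /negPf.
by rewrite eq_sym => ->; rewrite mulr0 mul0r.
Qed.

Lemma incidence_pt_block_gram (s t : 'I_12) :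
  \sum_(i < 9) \sum_(k < 5) incidence (f (point i)) s * incidence (f (point i)) t =
  5 * (2 * block_gram s t - incidence (f ord_max) s * incidence (f ord_max) t).
Proof.
under eq_bigr => i _ do rewrite sumr_const card_ord -mulr_natl.
rewrite -mulr_sumr; congr (_ * _).
by rewrite (sum_perm_pt (fun p => incidence p s * incidence p t)) incidence_block_gram.
Qed.

End Perm.

(** * The diagonal of the third power of the Gram matrix *)

Definition cube (g : line -> line -> Z) (k : line) : Z :=
  \sum_l \sum_m g k l * (g l m * g m k).

Lemma sum_line (F : line -> Z) :
  \sum_k F k = \sum_(i < 9) \sum_(j < 5) F (inl (i, j)) + \sum_s F (inr s).
Proof. by rewrite big_sumType pair_bigA; congr (_ + _); apply: eq_bigr => -[]. Qed.

(** The walks are split by the number of block lines on them: none, one (in either of two positions)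
    or two. *)
Lemma cube_edge b f (i : 'I_9) (k : 'I_5) : cube (gram b f) (inl (i, k)) =
  edge_cube b i k + 2 * (row_gram (f ord_max) (f (point i)) + 120)
  + block_form (f (point i)).
Proof.
set p := f (point i); set u := f ord_max.
(* The constant 120 is 12 blocks times the 10 of [edge_gram_incidence]. *)
have cross : \sum_(s < 12) (\sum_(j < 9) \sum_(l < 5)
    edge_gram b i k j l * incidence (f (point j)) s) * incidence p s = row_gram u p + 120.
  under eq_bigr => s _ do rewrite edge_gram_incidence mulrDl -mulrA incidence_sqr mulr1.
  rewrite big_split /= (ZsumE 12 (fun s => incidence u s * incidence p s)).
  by rewrite sumr_const card_ord -mulr_natl.
rewrite /cube sum_line /=.
under eq_bigr => j _ do under eq_bigr => l _ do rewrite sum_line /=.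
under [X in _ + X]eq_bigr => s _ do rewrite sum_line /=.
have -> : edge_cube b i k = \sum_(j < 9) \sum_(l < 5) \sum_(j' < 9) \sum_(l' < 5)
    edge_gram b i k j l * (edge_gram b j l j' l' * edge_gram b j' l' i k).
  rewrite /edge_cube -ZsumE; apply: eq_bigr => j _; rewrite -ZsumE.
  apply: eq_bigr => l _; rewrite -ZsumE mulr_sumr.
  by apply: eq_bigr => j' _; rewrite -ZsumE mulr_sumr.
have -> : block_form p = \sum_(s < 12) \sum_(t < 12)
    incidence p s * (block_gram s t * incidence p t).
  rewrite /block_form -ZsumE; apply: eq_bigr => s _.
  by rewrite -ZsumE mulr_sumr.
have <- : \sum_(j < 9) \sum_(l < 5) \sum_(s < 12)
    edge_gram b i k j l * (incidence (f (point j)) s * incidence p s) =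
    row_gram u p + 120.
  rewrite -cross; under eq_bigr => j _ do rewrite exchange_big.
  rewrite exchange_big; apply: eq_bigr => s _; rewrite mulr_suml.
  apply: eq_bigr => j _; rewrite mulr_suml.
  by apply: eq_bigr => l _; rewrite mulrA.
have E : \sum_(s < 12) \sum_(j < 9) \sum_(l < 5)
    incidence p s * (incidence (f (point j)) s * edge_gram b j l i k) =
    \sum_(j < 9) \sum_(l < 5) \sum_(s < 12)
    edge_gram b i k j l * (incidence (f (point j)) s * incidence p s).
  rewrite exchange_big; apply: eq_bigr => j _.
  rewrite exchange_big; apply: eq_bigr => l _.
  by apply: eq_bigr => s _; rewrite (edge_gram_sym b j i l k); ring.
under eq_bigr => j _ do rewrite big_split.
rewrite !big_split /= E.
by rewrite mulr_natl mulr2n !addrA.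
Qed.

Lemma cube_block b f (s : 'I_12) :
  cube (gram b f) (inr s) = block_cube (f ord_max) s.
Proof.
set u := f ord_max; rewrite /cube sum_line /=.
under eq_bigr => j _ do under eq_bigr => l _ do rewrite sum_line /=.
under [X in _ + X]eq_bigr => t _ do rewrite sum_line /=.
have blocks3 : \sum_(t < 12) \sum_(t' < 12)
      block_gram s t * (block_gram t t' * block_gram t' s) =
    Zsum 12 (fun t => block_gram s t *
      Zsum 12 (fun t' => block_gram t t' * block_gram t' s)).
  rewrite -ZsumE; apply: eq_bigr => t _.
  by rewrite -ZsumE mulr_sumr.
have cross : \sum_(t < 12) \sum_(j < 9) \sum_(l < 5)
    block_gram s t * (incidence (f (point j)) t * incidence (f (point j)) s) =
    Zsum 12 (fun t =>
      5 * (2 * block_gram s t - incidence u s * incidence u t) * block_gram t s).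
  rewrite -ZsumE; apply: eq_bigr => t _; rewrite -incidence_pt_block_gram mulr_suml.
  apply: eq_bigr => j _; rewrite mulr_suml; apply: eq_bigr => l _.
  by rewrite (block_gram_sym t s); ring.
have E : \sum_(j < 9) \sum_(l < 5) \sum_(t < 12)
    incidence (f (point j)) s * (incidence (f (point j)) t * block_gram t s) =
    \sum_(t < 12) \sum_(j < 9) \sum_(l < 5)
    block_gram s t * (incidence (f (point j)) t * incidence (f (point j)) s).
  under eq_bigr => j _ do rewrite exchange_big.
  rewrite exchange_big; apply: eq_bigr => t _; apply: eq_bigr => j _.
  by apply: eq_bigr => l _; rewrite (block_gram_sym t s); ring.
(* By [edge_gram_incidence] each of the 45 edge lines gives 10 plus a product with the sign of the
   free point; these products sum to -5. *)
have diag : \sum_(j < 9) \sum_(l < 5) \sum_(j' < 9) \sum_(l' < 5)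
    incidence (f (point j)) s *
      (edge_gram b j l j' l' * incidence (f (point j')) s) = 445.
  under eq_bigr => j _ do under eq_bigr => l _ do
    ((under eq_bigr => j' _ do rewrite -mulr_sumr);
     rewrite -mulr_sumr edge_gram_incidence).
  under eq_bigr => j _ do rewrite sumr_const card_ord mulrDr mulrCA incidence_sqr mulr1.
  rewrite sumrMnl big_split /= -mulr_suml sum_incidence_pt mulNr incidence_sqr.
  by rewrite sumr_const card_ord.
under eq_bigr => j _ do rewrite big_split.
rewrite !big_split /= E cross diag blocks3.
rewrite /block_cube; set X := Zsum 12 _; set Y := Zsum 12 _; move: X Y => X Y; ring.
Qed.

(** The threshold 1330 separates edge lines from block lines. The edge-only part is always 997, so
    only the placed point and the free point have to be enumerated. *)
Lemma cube_edge_le b f x : cube (gram b f) (inl x) <= 1330.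
Proof.
case: x => i k; rewrite cube_edge.
have -> : edge_cube b i k = 997.
  have H d : all_lt 9 (fun i => all_lt 5 (fun k => edge_cube d i k == 997)).
    by case: d; vm_compute.
  by apply/eqP; exact: (all_ltP k (all_ltP i (H b))).
(* The enumeration below covers only pairs of distinct points. *)
have : f (point i) != f ord_max :> nat.
  rewrite (inj_eq val_inj) (inj_eq (@perm_inj _ f)) -(inj_eq val_inj) /=.
  by rewrite neq_ltn ltn_ord.
have H : all_lt 10 (fun p => all_lt 10 (fun u => (p != u) ==>
    (997 + 2 * (row_gram u p + 120) + block_form p <= 1330))) by vm_compute.
exact: (implyP (all_ltP (f ord_max) (all_ltP (f (point i)) H))).
Qed.

Lemma cube_block_gt b f s : 1330 < cube (gram b f) (inr s).
Proof.
have H : all_lt 10 (fun u => all_lt 12 (fun s => 1330 < block_cube u s)).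
  by vm_compute.
by rewrite cube_block; exact: (all_ltP s (all_ltP (f ord_max) H)).
Qed.

(** * Invariants that identify the factors *)

Definition triangles b (i j m : nat) : Z :=
  Zsum 5 (fun k => Zsum 5 (fun l => edge_gram b i k j l *
    Zsum 5 (fun n => edge_gram b j l m n * edge_gram b m n i k))).
(** Without the exponent the sum would be 5 * 997 for every factor, as [edge_cube] is constant. *)
Definition colour_invariant b i : Z :=
  Zsum 9 (fun j => Zsum 9 (fun m => triangles b i j m ^+ 3)).

Lemma colour_invariant_inj b c (i j : 'I_9) :
  colour_invariant b i = colour_invariant c j -> b = c /\ i = j.
Proof.
(* All 18 invariants in one sequence: the indices 0 to 8 belong to [true], 9 to 17 to [false]. *)
pose W k := colour_invariant (k < 9)%N (k %% 9).
have /mkseq_uniqP W_inj : uniq (mkseq W 18) by vm_compute.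
have WE b' (i' : 'I_9) : colour_invariant b' i' = W ((~~ b') * 9 + i')%N.
  by rewrite /W modnMDl modn_small //; case: b'; rewrite /= ?ltn_ord.
have lt b' (i' : 'I_9) : ((~~ b') * 9 + i')%N \in gtn 18.
  by rewrite inE; case: b'; have := ltn_ord i'; lia.
rewrite !WE => /(W_inj _ _ (lt _ _) (lt _ _)) E.
have [ib ic] := (ltn_ord i, ltn_ord j).
have bc : b = c by case: b E; case: c => //= E; lia.
by split=> //; move: E; rewrite bc => /addnI/val_inj.
Qed.

Lemma row_gramE p q : row_gram p q = \sum_(s < 12) incidence p s * incidence q s.
Proof. by rewrite (ZsumE 12 (fun s => incidence p s * incidence q s)). Qed.

(** The sign rows of distinct points are neither equal nor opposite, so a row known up to sign
    determines its point. *)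
Lemma row_gram_facts (p q : 'I_10) :
  (row_gram p q == 12) = (p == q) /\ row_gram p q != - 12.
Proof.
have H : all_lt 10 (fun p => all_lt 10 (fun q =>
    ((row_gram p q == 12) == (p == q)) && (row_gram p q != - 12))) by vm_compute.
by have /andP[/eqP -> ->] := all_ltP q (all_ltP p H).
Qed.

(** * Consequences of an isomorphism of Gram matrices up to switching *)

Section SwitchingIsomorphism.
Variables (b c : bool) (f h : {perm 'I_10}) (phi : line -> line) (e : line -> Z).
Hypotheses (phi_inj : injective phi) (e2 : forall k, e k * e k = 1).
Hypothesis gram_phi : forall k l,
  gram b f k l = e k * e l * gram c h (phi k) (phi l).

(** A closed walk uses the switching sign of each of its lines twice. *)
Lemma cube_phi k : cube (gram b f) k = cube (gram c h) (phi k).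
Proof.
rewrite /cube [RHS](reindex_inj phi_inj); apply: eq_bigr => l _.
rewrite [RHS](reindex_inj phi_inj); apply: eq_bigr => m _.
rewrite (gram_phi k l) (gram_phi l m) (gram_phi m k).
set x := gram c h _ _; set y := gram c h _ _; set z := gram c h _ _.
transitivity ((e k * e k) * ((e l * e l) * (e m * e m)) * (x * (y * z))); first by ring.
by rewrite !e2 !mul1r.
Qed.

(** The fallback value is never taken, since [phi] respects the two kinds of lines ([phi_inl],
    [phi_inr]). *)
Definition phiA x := if phi (inl x) is inl y then y else x.
Definition phiB s := if phi (inr s) is inr t then t else s.

Lemma phi_inl x : phi (inl x) = inl (phiA x).
Proof.
rewrite /phiA; have := cube_phi (inl x); case: (phi _) => // s.
by move=> E; have := cube_block_gt c h s; rewrite -E ltNge cube_edge_le.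
Qed.

Lemma phi_inr s : phi (inr s) = inr (phiB s).
Proof.
rewrite /phiB; have := cube_phi (inr s); case: (phi _) => // x.
by move=> E; have := cube_block_gt b f s; rewrite E ltNge cube_edge_le.
Qed.

Lemma phiA_inj : injective phiA.
Proof.
move=> x y E; have : phi (inl x) = phi (inl y) by rewrite !phi_inl E.
by move/phi_inj => [].
Qed.

Lemma phiB_inj : injective phiB.
Proof.
move=> s t E; have : phi (inr s) = phi (inr t) by rewrite !phi_inr E.
by move/phi_inj => [].
Qed.

Lemma incidence_phi (x : 'I_9 * 'I_5) (s : 'I_12) : incidence (f (point x.1)) s =
  e (inl x) * e (inr s) * incidence (h (point (phiA x).1)) (phiB s).
Proof. by have := gram_phi (inl x) (inr s); rewrite phi_inl phi_inr. Qed.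

Lemma edge_gram_phi (x y : 'I_9 * 'I_5) :
  edge_gram b x.1 x.2 y.1 y.2 = e (inl x) * e (inl y) *
  edge_gram c (phiA x).1 (phiA x).2 (phiA y).1 (phiA y).2.
Proof. by have := gram_phi (inl x) (inl y); rewrite !phi_inl. Qed.

Lemma row_gram_phi (x y : 'I_9 * 'I_5) : row_gram (f (point x.1)) (f (point y.1)) =
  e (inl x) * e (inl y) * row_gram (h (point (phiA x).1)) (h (point (phiA y).1)).
Proof.
rewrite !row_gramE [in RHS](reindex_inj phiB_inj) mulr_sumr; apply: eq_bigr => s _.
rewrite !incidence_phi; set n := incidence _ _; set m := incidence _ _.
transitivity (e (inr s) * e (inr s) * (e (inl x) * e (inl y) * (n * m))); first by ring.
by rewrite e2 mul1r.
Qed.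

Lemma sgn_cases k : e k = 1 \/ e k = -1.
Proof. by have := e2 k; nia. Qed.

(** Two edge lines have the same factor exactly when [row_gram] of their points is 12. Switching
    could only turn this into -12, which does not occur. *)
Lemma colour_phi x y : ((phiA x).1 == (phiA y).1) = (x.1 == y.1).
Proof.
have ptE (u : {perm 'I_10}) i j : (u (point i) == u (point j)) = (i == j).
  by rewrite (inj_eq perm_inj).
have [E N] := row_gram_facts (f (point x.1)) (f (point y.1)).
have [E' N'] := row_gram_facts (h (point (phiA x).1)) (h (point (phiA y).1)).
rewrite -(ptE f x.1) -(ptE h (phiA x).1) -E -E'; move: N N'; rewrite row_gram_phi.
set d := row_gram _ _.
by case: (sgn_cases (inl x)) => ->; case: (sgn_cases (inl y)) => ->; lia.
Qed.

(** Both sides of [row_gram_phi] contain the value 12, so the product of the signs is 1. *)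
Lemma sgn_colour x y : x.1 = y.1 -> e (inl x) = e (inl y).
Proof.
move=> xy; have := row_gram_phi x y; rewrite xy.
have /eqP : (phiA x).1 == (phiA y).1 by rewrite colour_phi xy.
move=> ->; have [] := row_gram_facts (f (point y.1)) (f (point y.1)).
have [] := row_gram_facts (h (point (phiA y).1)) (h (point (phiA y).1)).
rewrite !eqxx => /eqP -> _ /eqP -> _.
by case: (sgn_cases (inl x)) => ->; case: (sgn_cases (inl y)) => ->.
Qed.

Lemma sum_colour (i : 'I_9) (F : 'I_9 * 'I_5 -> Z) :
  \sum_(k < 5) F (i, k) = \sum_(x | x.1 == i) F x.
Proof.
transitivity (\sum_(j | j == i) \sum_(k < 5) F (j, k)).
  by rewrite big_pred1_eq.
rewrite pair_big_dep /=.
by apply: eq_big => [[j k]|[j k] _] //=; rewrite andbT.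
Qed.

Lemma trianglesE d (i j m : 'I_9) : triangles d i j m =
  \sum_(x : 'I_9 * 'I_5 | x.1 == i) \sum_(y : 'I_9 * 'I_5 | y.1 == j)
  \sum_(z : 'I_9 * 'I_5 | z.1 == m)
    edge_gram d x.1 x.2 y.1 y.2 *
      (edge_gram d y.1 y.2 z.1 z.2 * edge_gram d z.1 z.2 x.1 x.2).
Proof.
rewrite /triangles -ZsumE -sum_colour; apply: eq_bigr => k _.
rewrite -ZsumE -sum_colour; apply: eq_bigr => l _.
by rewrite -ZsumE -sum_colour mulr_sumr.
Qed.

(** The induced map on factors; by [colour_phi] any edge of the factor could replace [ord0]. *)
Definition rho (i : 'I_9) : 'I_9 := (phiA (i, ord0)).1.

Lemma phiA_colour x (i : 'I_9) : ((phiA x).1 == rho i) = (x.1 == i).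
Proof. exact: colour_phi. Qed.

Lemma triangles_phi (i j m : 'I_9) :
  triangles b i j m = triangles c (rho i) (rho j) (rho m).
Proof.
have sumA (F : 'I_9 * 'I_5 -> Z) l :
    \sum_(x | x.1 == rho l) F x = \sum_(x | x.1 == l) F (phiA x).
  rewrite (reindex_inj phiA_inj).
  by apply: eq_bigl => x; rewrite phiA_colour.
rewrite !trianglesE sumA; apply: eq_bigr => x _.
rewrite sumA; apply: eq_bigr => y _; rewrite sumA; apply: eq_bigr => z _.
rewrite (edge_gram_phi x y) (edge_gram_phi y z) (edge_gram_phi z x).
set p := edge_gram c _ _ _ _; set q := edge_gram c _ _ _ _; set r := edge_gram c _ _ _ _.
transitivity ((e (inl x) * e (inl x)) * ((e (inl y) * e (inl y))
  * (e (inl z) * e (inl z))) * (p * (q * r))); first by ring.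
by rewrite !e2 !mul1r.
Qed.

Lemma colour_invariant_phi (i : 'I_9) : colour_invariant b i = colour_invariant c (rho i).
Proof.
have rho_inj : injective rho.
  by move=> j l /eqP; rewrite phiA_colour => /eqP.
rewrite /colour_invariant -!ZsumE [RHS](reindex_inj rho_inj); apply: eq_bigr => j _.
rewrite -!ZsumE [RHS](reindex_inj rho_inj); apply: eq_bigr => m _.
by rewrite triangles_phi.
Qed.

Lemma factorization_phi : b = c.
Proof. by have [] := colour_invariant_inj (colour_invariant_phi ord0). Qed.

Lemma phiA_fst x : (phiA x).1 = x.1.
Proof.
have [_ E] := colour_invariant_inj (colour_invariant_phi x.1).
by apply/eqP; rewrite [X in _ == X]E phiA_colour.
Qed.

(** Signs are already constant on factors. The sum of the Gram entries between two distinct factors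
    is -5 on both sides, hence nonzero, so their signs agree. *)
Lemma sgn_const x y : e (inl x) = e (inl y).
Proof.
have [/sgn_colour //|xy] := eqVneq x.1 y.1.
have block_sum d (i j : 'I_9) : i != j ->
    \sum_(z : 'I_9 * 'I_5 | z.1 == i) \sum_(t : 'I_9 * 'I_5 | t.1 == j)
      edge_gram d z.1 z.2 t.1 t.2 = - 5.
  move=> /negPf ij; rewrite -sum_colour.
  under eq_bigr => k _ do rewrite
    -(sum_colour j (fun t => edge_gram d i k t.1 t.2)) edge_gram_factor ij.
  by rewrite sumr_const card_ord.
have sumA (F : 'I_9 * 'I_5 -> Z) l :
    \sum_(z | z.1 == l) F z = \sum_(z | z.1 == l) F (phiA z).
  rewrite (reindex_inj phiA_inj).
  by apply: eq_bigl => z; rewrite phiA_fst.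
have : \sum_(z : 'I_9 * 'I_5 | z.1 == x.1) \sum_(t : 'I_9 * 'I_5 | t.1 == y.1)
      edge_gram b z.1 z.2 t.1 t.2 = e (inl x) * e (inl y) *
    \sum_(z : 'I_9 * 'I_5 | z.1 == x.1) \sum_(t : 'I_9 * 'I_5 | t.1 == y.1)
      edge_gram c z.1 z.2 t.1 t.2.
  rewrite [in RHS]sumA mulr_sumr; apply: eq_bigr => z /eqP zx.
  rewrite [in RHS]sumA mulr_sumr; apply: eq_bigr => t /eqP ty.
  by rewrite edge_gram_phi (sgn_colour zx) (sgn_colour ty).
rewrite !block_sum //.
by case: (sgn_cases (inl x)) => ->; case: (sgn_cases (inl y)) => ->.
Qed.

(** The nine placed points follow from [incidence_phi]; the free point follows because its sign is
    minus the sum of the other nine. *)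
Lemma incidence_perm (j : 'I_10) (s : 'I_12) : incidence (f j) s =
  e (inl (ord0, ord0)) * e (inr s) * incidence (h j) (phiB s).
Proof.
have incA (i : 'I_9) : incidence (f (point i)) s =
    e (inl (ord0, ord0)) * e (inr s) * incidence (h (point i)) (phiB s).
  by rewrite (incidence_phi (i, ord0)) phiA_fst (sgn_const _ (ord0, ord0)).
have [i ->|->] := unliftP ord_max j.
  have -> : lift ord_max i = point i by apply: val_inj; exact: lift_max.
  exact: incA.
apply: oppr_inj; rewrite -mulrN -!sum_incidence_pt mulr_sumr.
by apply: eq_bigr => i _; rewrite incA.
Qed.

Lemma quad_perm (i j k l : 'I_10) :
  quad (f i) (f j) (f k) (f l) = quad (h i) (h j) (h k) (h l).
Proof.
rewrite /quad -!ZsumE [RHS](reindex_inj phiB_inj); apply: eq_bigr => s _.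
rewrite !incidence_perm; set a := e _; set n := incidence _ _; set m := incidence _ _.
set o := incidence _ _; set p := incidence _ _.
transitivity ((a * a) * (a * a) * ((e (inr s) * e (inr s)) *
  (e (inr s) * e (inr s))) * (n * m * (o * p))); first by ring.
by rewrite !e2 !mul1r.
Qed.

End SwitchingIsomorphism.

(** * Automorphisms of the quadruple sums *)

Definition quad_auts : {set {perm 'I_10}} := [set s : {perm 'I_10} | [forall i : 'I_10,
  forall j : 'I_10, forall k : 'I_10, forall l : 'I_10,
  quad (s i) (s j) (s k) (s l) == quad i j k l]].

Lemma quad_autsP (s : {perm 'I_10}) :
  reflect (forall i j k l : 'I_10, quad (s i) (s j) (s k) (s l) = quad i j k l)
    (s \in quad_auts).
Proof.
rewrite inE; apply: (iffP idP) => [H i j k l|H].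
  by move/'forall_'forall_'forall_'forall_eqP: H.
by apply/'forall_'forall_'forall_'forall_eqP.
Qed.

Lemma quad_autsV (s : {perm 'I_10}) : s \in quad_auts -> (s^-1)%g \in quad_auts.
Proof.
move/quad_autsP => H; apply/quad_autsP => i j k l.
by rewrite -H !permKV.
Qed.

Lemma quad_autsM (s t : {perm 'I_10}) :
  s \in quad_auts -> t \in quad_auts -> (s * t)%g \in quad_auts.
Proof.
move=> /quad_autsP Hs /quad_autsP Ht; apply/quad_autsP => i j k l.
by rewrite !permM Ht Hs.
Qed.

(** The point [t] is told apart from all others by its quadruple sums with triples from [K], so an
    automorphism fixing [K] pointwise fixes [t]. *)
Definition separated (K : seq nat) (t : nat) : bool :=
  all_lt 10 (fun t' => (t' == t) || has (fun a => has (fun b => has (fun c =>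
    quad t' a b c != quad t a b c) K) K) K).

Definition fixes (s : {perm 'I_10}) (K : seq nat) :=
  forall i : 'I_10, nat_of_ord i \in K -> s i = i.

Lemma fixes_separated (s : {perm 'I_10}) K : s \in quad_auts ->
  all (ltn^~ 10)%N K -> fixes s K -> fixes s (filter (separated K) (iota 0 10)).
Proof.
move=> /quad_autsP Hs /allP K10 fK t; rewrite mem_filter => /andP[sep _].
have := all_ltP (s t) sep => /orP[/eqP/val_inj //|].
move=> /hasP[a aK] /hasP[b bK] /hasP[c cK] /eqP[].
have := Hs t (Ordinal (K10 a aK)) (Ordinal (K10 b bK)) (Ordinal (K10 c cK)).
by rewrite (fK (Ordinal _) aK) (fK (Ordinal _) bK) (fK (Ordinal _) cK).
Qed.

(* 0 and 2 are adjacent faces of the cube. *)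
Lemma quad_auts_rigid (s : {perm 'I_10}) :
  s \in quad_auts -> s (inord 0) = inord 0 -> s (inord 2) = inord 2 -> s = 1%g.
Proof.
move=> Hs s0 s2; pose step K := filter (separated K) (iota 0 10).
have f0 : fixes s [:: 0; 2]%N.
  by move=> i; rewrite !inE => /orP[] /eqP E; rewrite -(inord_val i) E.
have fn n : fixes s (iter n step [:: 0; 2]%N) /\
    all (ltn^~ 10)%N (iter n step [:: 0; 2]%N).
  elim: n => [|n [IHf IHa]]; first by split.
  split; first exact: fixes_separated.
  by apply/allP => x /=; rewrite mem_filter mem_iota => /and3P[].
(* Three rounds of adding separated points reach all ten. *)
have full : iter 3 step [:: 0; 2]%N = iota 0 10 by vm_compute.
have [f3 _] := fn 3; apply/permP => i; rewrite perm1.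
by apply: f3; rewrite full mem_iota ltn_ord.
Qed.

Lemma quad_row_gram p q r : quad p q r r = row_gram p q.
Proof.
rewrite /quad /row_gram -!ZsumE; apply: eq_bigr => s _.
by rewrite incidence_sqr mulr1.
Qed.

(** By rigidity the images of 0 and 2 determine an automorphism; they form an ordered pair of
    adjacent faces, with 6 * 4 possibilities. *)
Lemma card_quad_auts : (#|quad_auts| <= 24)%N.
Proof.
pose v (s : {perm 'I_10}) := (val (s (inord 0)), val (s (inord 2))).
(* Opposite faces have row_gram -4, so L lists the pairs of adjacent faces. *)
pose L := filter (fun x =>
    (row_gram x.1 x.2 == 0) && ~~ all_lt 10 (fun k => row_gram x.1 k != - 4))
  [seq (a, b) | a <- iota 0 10, b <- iota 0 10].
have -> : 24%N = size L by vm_compute.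
rewrite cardE -(size_map v); apply: uniq_leq_size.
  rewrite map_inj_in_uniq ?enum_uniq // => s t; rewrite !mem_enum => Hs Ht [E0 E2].
  apply/eqP; rewrite eq_mulgV1; apply/eqP; apply: quad_auts_rigid.
  - by rewrite quad_autsM // quad_autsV.
  - by rewrite permM (val_inj E0) permK.
  - by rewrite permM (val_inj E2) permK.
move=> x /mapP[s]; rewrite mem_enum => /quad_autsP Hs ->.
rewrite mem_filter; apply/andP; split; last first.
  by apply/allpairsP; exists (v s); rewrite !mem_iota /= !ltn_ord.
have row_gram_aut i j : row_gram (s i) (s j) = row_gram i j.
  by rewrite -(quad_row_gram _ _ (s i)) -(quad_row_gram i j i) Hs.
rewrite row_gram_aut !inordK //; apply/andP; split; first by vm_compute.
(* The face opposite to 0 is 1, and its image is opposite to the image of 0. *)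
apply/negP => H; have := @all_ltP _ _ (s (inord 1)) H.
by rewrite row_gram_aut !inordK.
Qed.

(** * Counting inequivalent parameters *)

(** Greedy choice: m chosen elements exclude at most m * k elements, which leaves one more as long
    as (m + 1) * k is at most the size of [X]. *)
Lemma exists_pairwise_unrelated (X : finType) (r : rel X) (k m : nat) : symmetric r -> (0 < k)%N ->
  (forall x, #|[set y | r x y]| <= k)%N -> (m * k <= #|X|)%N ->
  exists s : seq X, size s = m /\ pairwise (fun x y => ~~ r x y) s.
Proof.
move=> r_sym k0 rk; suff H : (m * k <= #|X|)%N -> exists s : seq X,
    [/\ size s = m, pairwise (fun x y => ~~ r x y) s &
    #|[set y | has (r^~ y) s]| <= m * k]%N.
  by case/H => s [? ? _]; exists s.
elim: m => [|m IH] mk.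
  by exists [::]; split=> //; rewrite leqn0 cards_eq0; apply/eqP/setP => y; rewrite !inE.
have [|s [sz pw card]] := IH; first by apply: leq_trans mk; rewrite leq_mul2r leqnSn orbT.
have [x xs] : exists x, x \notin [set y | has (r^~ y) s].
  apply/existsP; rewrite -negb_forall; apply/negP => /forallP all_in.
  have : (#|X| <= m * k)%N.
    by apply: leq_trans card; apply: subset_leq_card; apply/subsetP => y _.
  by rewrite leqNgt (leq_trans _ mk) // mulSn -addn1 addnC leq_add2r.
exists (x :: s); split => /=; first by rewrite sz.
  rewrite pw andbT; apply/allP => y ys; apply: contra xs => xy.
  by rewrite inE; apply/hasP; exists y => //; rewrite r_sym.
have -> : [set y | r x y || has (r^~ y) s] = [set y | r x y] :|: [set y | has (r^~ y) s].
  by apply/setP => y; rewrite !inE.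
by rewrite cardsU; apply: leq_trans (leq_subr _ _) _; rewrite mulSn leq_add.
Qed.

(** Products of permutations act from left to right, so [x.2^-1 * y.2] sends [x.2 p] to [y.2 p]. *)
Definition equiv_params (x y : bool * {perm 'I_10}) : bool :=
  (x.1 == y.1) && ((x.2^-1 * y.2)%g \in quad_auts).

Lemma inequivalent_params n : (n * 24 <= 2 * 10`!)%N ->
  exists x : 'I_n -> bool * {perm 'I_10},
    forall i j, i != j -> ~~ equiv_params (x i) (x j).
Proof.
have sym : symmetric equiv_params.
  move=> x y; rewrite /equiv_params eq_sym; congr (_ && _).
  by apply/idP/idP => /quad_autsV; rewrite invMg invgK.
have card x : (#|[set y | equiv_params x y]| <= 24)%N.
  apply: leq_trans card_quad_auts.
  apply: leq_trans (leq_imset_card (fun s => (x.1, x.2 * s)%g) _).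
  apply: subset_leq_card; apply/subsetP => -[b f]; rewrite inE => /andP[/eqP /= <- H].
  by apply/imsetP; exists (x.2^-1 * f)%g => //; rewrite mulKVg.
move=> n24; have [|s [sz pw]] := @exists_pairwise_unrelated _ _ _ n sym (isT : 0 < 24)%N card.
  by rewrite card_prod card_bool card_Sn.
exists (fun i => nth (true, 1%g) s i).
have lt (i j : 'I_n) : (i < j)%N ->
    ~~ equiv_params (nth (true, 1%g) s i) (nth (true, 1%g) s j).
  by move=> ij; apply: (pairwiseP (true, 1%g) pw) => //; rewrite inE sz.
move=> i j; rewrite neq_ltn => /orP[/lt //|/lt].
by rewrite sym.
Qed.

(* 246896 = 208 * 1187; the literal itself is opaque to lia. *)
Lemma count_params : (246896 * 24 <= 2 * 10`!)%N.
Proof.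
apply: (@leq_trans (208 * 1187 * 24)%N); last by rewrite !factS fact0; lia.
by rewrite leq_pmul2r //; vm_compute.
Qed.

(** * Inner products and the simplex in dimension 9 *)

Section Dot.
Variable R : realType.

Lemma dotC d (u v : 'rV[R]_d) : dot u v = dot v u.
Proof. by apply: eq_bigr => i _; rewrite mulrC. Qed.

Lemma dotZl d a (u v : 'rV[R]_d) : dot (a *: u) v = a * dot u v.
Proof. by rewrite mulr_sumr; apply: eq_bigr => i _; rewrite mxE mulrA. Qed.

Lemma dotZr d a (u v : 'rV[R]_d) : dot u (a *: v) = a * dot u v.
Proof. by rewrite dotC dotZl dotC. Qed.

Lemma dot_suml d (I : Type) (s : seq I) (F : I -> 'rV[R]_d) v :
  dot (\sum_(i <- s) F i) v = \sum_(i <- s) dot (F i) v.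
Proof.
rewrite exchange_big; apply: eq_bigr => j _.
by rewrite summxE mulr_suml.
Qed.

Lemma dot_sumr d (I : Type) (s : seq I) (F : I -> 'rV[R]_d) v :
  dot v (\sum_(i <- s) F i) = \sum_(i <- s) dot v (F i).
Proof. by rewrite dotC dot_suml; apply: eq_bigr => i _; rewrite dotC. Qed.

Lemma dot_row_mx m n (a c : 'rV[R]_m) (b d : 'rV[R]_n) :
  dot (row_mx a b) (row_mx c d) = dot a c + dot b d.
Proof.
rewrite /dot big_split_ord; congr (_ + _); apply: eq_bigr => i _.
  by rewrite !row_mxEl.
by rewrite !row_mxEr.
Qed.

(** Ten vertices of a regular simplex centred at the origin. With r the root of 1/10, the shift (r -
    1) / 9 makes the first nine sum to the all-r vector, which the tenth cancels. *)
Definition vertex (i : nat) : 'rV[R]_9 :=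
  if (i < 9)%N then \row_j ((j == i :> nat)%:R + (Num.sqrt 10^-1 - 1) / 9)
  else \row_j (- Num.sqrt 10^-1).

Lemma dot_vertex (i j : nat) : (i < 10)%N -> (j < 10)%N ->
  dot (vertex i) (vertex j) = (i == j)%:R - 10^-1.
Proof.
set r : R := Num.sqrt 10^-1; have rr : r * r = 10^-1.
  by rewrite -expr2 sqr_sqrtr // invr_ge0.
have sum_delta (k : nat) (a : R) : (k < 9)%N ->
    \sum_(l < 9) (l == k :> nat)%:R * a = a.
  move=> k9; rewrite (bigD1 (Ordinal k9)) //= eqxx mul1r big1 ?addr0 // => l.
  by rewrite -(inj_eq val_inj) => /negPf /= ->; rewrite mul0r.
have sumc (a : R) : \sum_(l < 9) a = 9 * a by rewrite sumr_const card_ord mulr_natl.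
rewrite /vertex -/r => i10 j10.
have lastE k : (k < 9)%N -> dot (\row_(l < 9) ((l == k :> nat)%:R + (r - 1) / 9))
    (\row_(l < 9) - r) = - 10^-1.
  move=> k9; rewrite /dot.
  under eq_bigr => l _ do rewrite !mxE mulrDl.
  by rewrite big_split /= sum_delta // sumc -rr; field.
case: (ltnP i 9) => [i9|]; case: (ltnP j 9) => [j9|].
- rewrite /dot; under eq_bigr => l _ do rewrite !mxE mulrDl mulrDr.
  rewrite big_split big_split /= sum_delta //.
  under [X in _ + X]eq_bigr => l _ do rewrite mulrC mulrDl.
  rewrite big_split /= sum_delta // sumc.
  have -> : \sum_(l < 9) (l == i :> nat)%:R * (l == j :> nat)%:R = (i == j)%:R :> R.
    rewrite (bigD1 (Ordinal i9)) //= eqxx mul1r big1 ?addr0 // => l.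
    by rewrite -(inj_eq val_inj) => /negPf /= ->; rewrite mul0r.
  (* For the shift c = (r - 1) / 9 one has 2c + 9c^2 = (r^2 - 1) / 9, which is -1/10. *)
  transitivity ((i == j)%:R + (r * r - 1) / 9); first by field.
  by rewrite rr; field.
- move=> j9; have -> : j = 9%N by lia.
  by rewrite lastE // ltn_eqF // sub0r.
- move=> i9; have -> : i = 9%N by lia.
  by rewrite dotC lastE // gtn_eqF // sub0r.
- move=> j9 i9; have [-> ->] : i = 9%N /\ j = 9%N by lia.
  rewrite /dot; under eq_bigr => l _ do rewrite !mxE.
  by rewrite sumc mulrNN rr eqxx mulr1n; field.
Qed.

Definition vertex_sum (p : seq nat) : 'rV[R]_9 := \sum_(i <- p) vertex i.

Lemma dot_vertex_sum (p q : seq nat) : all (ltn^~ 10)%N p -> all (ltn^~ 10)%N q ->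
  uniq q -> dot (vertex_sum p) (vertex_sum q) =
  (common p q)%:R - (size p * size q)%:R / 10.
Proof.
move=> /allP p10 /allP q10 uq; rewrite dot_suml.
transitivity (\sum_(i <- p) ((i \in q)%:R - (size q)%:R / 10 : R)).
  rewrite big_seq [RHS]big_seq; apply: eq_bigr => i ip; rewrite dot_sumr.
  transitivity (\sum_(j <- q) ((i == j)%:R - 10^-1 : R)).
    rewrite big_seq [RHS]big_seq; apply: eq_bigr => j jq.
    by apply: dot_vertex; [exact: p10|exact: q10].
  rewrite sumrB -natr_sum big_const_seq count_predT iter_addr_0 mulr_natl.
  congr (_%:R - _).
  rewrite -(count_uniq_mem _ uq) -sum1_count [RHS]big_mkcond /=.
  by apply: eq_bigr => j _; rewrite eq_sym; case: eqP.
rewrite sumrB -natr_sum big_const_seq count_predT iter_addr_0 natrM -mulrA mulr_natl.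
congr (_%:R - _); last by rewrite mulr_natl.
by rewrite /common -sum1_count [RHS]big_mkcond; apply: eq_bigr => i _; case: (i \in q).
Qed.

End Dot.

(** * The sets of 57 lines *)

Section Config.
Variable R : realType.

Definition Zreal (z : Z) : R := (int_of_Z z)%:~R.
HB.instance Definition _ := GRing.RMorphism.copy Zreal (intr \o int_of_Z).
Lemma ZrealB (x y : Z) : Zreal (x - y) = Zreal x - Zreal y.
Proof. exact: rmorphB. Qed.
Lemma ZrealD (x y : Z) : Zreal (x + y) = Zreal x + Zreal y.
Proof. exact: rmorphD. Qed.
Lemma ZrealM (x y : Z) : Zreal (x * y) = Zreal x * Zreal y.
Proof. exact: rmorphM. Qed.
Lemma ZrealN1 : Zreal (- 1) = - 1.
Proof. exact: rmorphN1. Qed.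
Lemma Zreal_nat n : Zreal n%:R = n%:R.
Proof. exact: rmorph_nat. Qed.

Lemma Zreal_inj : injective Zreal.
Proof. by move=> x y /intr_inj /(can_inj int_of_ZK). Qed.

(* [(p, q)] stands for the vector (sum of w_i for i in p, sum of w_i for i in q). *)
Definition support b (f : {perm 'I_10}) (k : line) : seq nat * seq nat :=
  match k with
  | inl x => ([:: nat_of_ord (f (point x.1))], edge b x.1 x.2)
  | inr s => (block s, [::])
  end.

Definition vec b f (k : line) : 'rV[R]_18 :=
  row_mx (vertex_sum R (support b f k).1) (vertex_sum R (support b f k).2) : 'rV_(9 + 9).

Lemma edge_facts b (i : 'I_9) (k : 'I_5) :
  [/\ all (ltn^~ 10)%N (edge b i k), uniq (edge b i k) & size (edge b i k) = 2%N].
Proof.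
have H d : all_lt 9 (fun i => all_lt 5 (fun k => [&& all (ltn^~ 10)%N (edge d i k),
    uniq (edge d i k) & size (edge d i k) == 2%N])) by case: d; vm_compute.
by have /and3P[? ? /eqP ?] := all_ltP k (all_ltP i (H b)).
Qed.

Lemma block_facts (s : 'I_12) :
  [/\ all (ltn^~ 10)%N (block s), uniq (block s) & size (block s) = 5%N].
Proof.
have H : all_lt 12 (fun s => [&& all (ltn^~ 10)%N (block s),
    uniq (block s) & size (block s) == 5%N]) by vm_compute.
by have /and3P[? ? /eqP ?] := all_ltP s H.
Qed.

Lemma dot_vec b f k l : dot (vec b f k) (vec b f l) = Zreal (gram b f k l) / 2.
Proof.
(* A sum coerces to the test for [inl]; by symmetry the case of a block line followed by an edge
   line is dropped. *)
wlog kl : k l / (k : line) || ~~ (l : line).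
  move=> H; case E : (k || ~~ l); first exact: H.
  by rewrite dotC gram_sym; apply: H; case: (k) (l) E => [?|?] [].
have wf (m : line) : let: (p, q) := support b f m in
    [/\ all (ltn^~ 10)%N p, all (ltn^~ 10)%N q, uniq p & uniq q].
  case: m => [[i n]|s] /=.
    by have [? ? _] := edge_facts b i n; split; rewrite //= andbT ltn_ord.
  by have [? ? _] := block_facts s; split.
rewrite /vec (dot_row_mx (m := 9) (n := 9)).
have [] := (wf k, wf l).
case: k l kl => [[i n]|s] [[j m]|t] //= _ [K1 K2 K3 K4] [L1 L2 L3 L4];
  rewrite !dot_vertex_sum //.
- have -> : Zreal (edge_gram b i n j m) =
      2 * (i == j)%:R + 2 * (common (edge b i n) (edge b j m))%:R - 1.
    by rewrite /edge_gram ZrealB ZrealD !ZrealM !Zreal_nat.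
  have [_ _ ->] := edge_facts b i n; have [_ _ ->] := edge_facts b j m.
  rewrite /common /= inE addn0 (inj_eq (@ord_inj _)) (inj_eq perm_inj).
  rewrite -(inj_eq (@ord_inj _)) /=.
  by field.
- have -> : Zreal (incidence (f (point i)) t) =
      2 * (nat_of_ord (f (point i)) \in block t)%:R - 1.
    by rewrite /incidence; case: ifP => _; rewrite ?rmorphN rmorph1 /=; ring.
  have [_ _ ->] := block_facts t.
  have -> : common (edge b i n) [::] = 0%N by exact: count_pred0.
  by rewrite /common /= addn0 muln0; field.
- have -> : Zreal (block_gram s t) = 2 * (common (block s) (block t))%:R - 5.
    by rewrite /block_gram ZrealB !ZrealM !Zreal_nat.
  have [_ _ ->] := block_facts s; have [_ _ ->] := block_facts t.
  by rewrite /common /=; field.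
Qed.

Lemma gram_diag b f k : gram b f k k = 5.
Proof.
have HB : all_lt 12 (fun s => block_gram s s == 5) by vm_compute.
have HA d : all_lt 9 (fun i => all_lt 5 (fun n => edge_gram d i n i n == 5)).
  by case: d; vm_compute.
case: k => [[i n]|s]; apply/eqP; first exact: (all_ltP n (all_ltP i (HA b))).
exact: (all_ltP s HB).
Qed.

Lemma gram_offdiag b f k l : k != l -> gram b f k l * gram b f k l = 1.
Proof.
have HB : all_lt 12 (fun s => all_lt 12 (fun t =>
    (s == t) || (block_gram s t * block_gram s t == 1))) by vm_compute.
have HA d : all_lt 9 (fun i => all_lt 5 (fun n => all_lt 9 (fun j => all_lt 5
    (fun m => ((i == j) && (n == m)) ||
      (edge_gram d i n j m * edge_gram d i n j m == 1))))).
  by case: d; vm_compute.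
case: k l => [[i n]|s] [[j m]|t]; rewrite ?incidence_sqr // => /negP kl; apply/eqP.
  have /orP[E|//] := all_ltP m (all_ltP j (all_ltP n (all_ltP i (HA b)))).
  by case: kl; exact: E.
by have /orP[E|//] := all_ltP t (all_ltP s HB); case: kl; exact: E.
Qed.

Lemma dot_vec_diag b f k : dot (vec b f k) (vec b f k) = 5 / 2.
Proof. by rewrite dot_vec gram_diag (Zreal_nat 5). Qed.

Lemma dot_vec_offdiag b f k l : k != l -> `|dot (vec b f k) (vec b f l)| = 2^-1.
Proof.
move=> /(gram_offdiag b f) g1.
have [E|E] : gram b f k l = 1 \/ gram b f k l = -1 by nia.
  by rewrite dot_vec E (Zreal_nat 1) mul1r ger0_norm // invr_ge0.
by rewrite dot_vec E ZrealN1 mulN1r normrN ger0_norm // invr_ge0.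
Qed.

Lemma vec_neq0 b f k : vec b f k != 0.
Proof.
apply: contra_eq_neq (dot_vec_diag b f k) => ->.
by rewrite -(scale0r 0) dotZl mul0r eq_sym mulf_neq0 ?invr_eq0 ?pnatr_eq0.
Qed.

Definition config b f : {fset {vspace 'rV[R]_18}} :=
  [fset <[vec b f k]>%VS | k in [set: line]]%fset.

(** Vectors of equal norm on one line differ by a sign, so their inner product would be 5/2 in
    absolute value instead of 1/2. *)
Lemma vline_vec_inj b f : injective (fun k => <[vec b f k]>%VS).
Proof.
move=> k l E; apply/eqP; apply: contraT => kl.
have /vlineP[a ka] : vec b f k \in <[vec b f l]>%VS by rewrite -E memv_line.
have := dot_vec_diag b f k; rewrite {1}ka dotZl => d1.
have := dot_vec_diag b f k; rewrite ka dotZl dotZr dot_vec_diag => d2.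
have := dot_vec_offdiag b f kl.
rewrite ka dotZl dot_vec_diag normrM => d3.
have : `|a| * `|a| = 1.
  rewrite -normrM (_ : a * a = 1) ?normr1 //.
  by move: d2; lra.
have : 0 <= `|a| by [].
have n52 : `|5 / 2| = 5 / 2 :> R by rewrite ger0_norm // divr_ge0.
move: d3; rewrite n52.
set t := `|a|; nra.
Qed.

Lemma card_config b f : #|` config b f| = 57%N.
Proof.
rewrite /config card_imfset /=; last exact: vline_vec_inj.
by rewrite -cardE cardsT card_sum card_prod !card_ord.
Qed.

Lemma mem_config b f k : <[vec b f k]>%VS \in config b f.
Proof. by apply/imfsetP; exists k; rewrite //= inE. Qed.

Lemma configP b f l : l \in config b f -> exists k, l = <[vec b f k]>%VS.
Proof. by move/imfsetP => [k _ ->]; exists k. Qed.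

Lemma equiangular_config b f : equiangular (acos (1 / 5)) (config b f).
Proof.
split=> [l /configP[k ->]|l m /configP[k ->] /configP[k' ->] kk' u v].
  by rewrite dim_vline vec_neq0.
move=> /vlineP[x ->] /vlineP[y ->] xu yv.
have {}kk' : k != k' by apply: contraNneq kk' => ->.
have x0 : x != 0 by apply: contraNneq xu => ->; rewrite scale0r.
have y0 : y != 0 by apply: contraNneq yv => ->; rewrite scale0r.
rewrite /line_angle; congr acos.
have normE z k0 : enorm (z *: vec b f k0) = `|z| * Num.sqrt (5 / 2).
  rewrite /enorm dotZl dotZr dot_vec_diag mulrA -expr2 sqrtrM ?sqr_ge0 //.
  by rewrite sqrtr_sqr.
rewrite !normE dotZl dotZr !normrM dot_vec_offdiag //.
have x1 : `|x| != 0 by rewrite normr_eq0.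
have y1 : `|y| != 0 by rewrite normr_eq0.
rewrite mulrACA -[X in _ / (_ * X)]expr2 sqr_sqrtr ?divr_ge0 //.
by field; rewrite x1 y1.
Qed.

(** * From isometries to equivalent parameters *)

Lemma sub_fspan (Phi : {fset {vspace 'rV[R]_18}}) l :
  l \in Phi -> (l <= fspan Phi)%VS.
Proof. by move=> lP; rewrite /fspan (big_rem l) //= addvSl. Qed.

(** An isometry sends each spanning vector to a multiple of a spanning vector of the other set;
    equal norms force the factor to be a sign. *)
Lemma isometric_config b f c h : isometric (config b f) (config c h) ->
  exists (phi : line -> line) (e : line -> Z), [/\ injective phi,
    forall k, e k * e k = 1 & forall k l,
    gram b f k l = e k * e l * gram c h (phi k) (phi l)].
Proof.
case=> F [F_dot F_im].
pose U := fspan (config b f).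
pose x k : subvs_of U := vsproj U (vec b f k).
have xE k : vsval (x k) = vec b f k.
  apply: vsprojK; apply: (subvP (sub_fspan (mem_config b f k))).
  exact: memv_line.
have Fx k : exists la : line * R, vsval (F (x k)) = la.2 *: vec c h la.1.
  have : line_image F <[vec b f k]>%VS \in [fset line_image F l | l in config b f]%fset.
    by apply/imfsetP; exists <[vec b f k]>%VS => //; apply: mem_config.
  rewrite F_im => /configP[l El].
  have : vsval (F (x k)) \in line_image F <[vec b f k]>%VS.
    rewrite -[vsval _](lfunE vsval); apply/memv_img/memv_img.
    by rewrite -memv_preim lfunE /= xE memv_line.
  by rewrite El => /vlineP[a Ea]; exists (l, a).
have /fin_all_exists[la laE] := Fx.
pose phi (k : line) : line := (la k).1; pose a (k : line) : R := (la k).2.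
have dotE k l : dot (vec b f k) (vec b f l) =
    a k * a l * dot (vec c h (phi k)) (vec c h (phi l)).
  by rewrite -!xE -F_dot !laE dotZl dotZr mulrA.
have a2 k : a k * a k = 1.
  by have := dotE k k; rewrite !dot_vec_diag => ?; lra.
(* The real scalar is 1 or -1 by [a2]; this is the same sign as an integer. *)
pose e k : Z := if a k == 1 then 1 else -1.
have eE k : a k = Zreal (e k).
  rewrite /e; case: eqP => [->|a1]; first by rewrite (Zreal_nat 1).
  rewrite ZrealN1; have /eqP := a2 k; rewrite -expr2 sqrf_eq1 => /orP[/eqP //|/eqP //].
have half0 : 2^-1 != 0 :> R by rewrite invr_eq0 pnatr_eq0.
exists phi, e; split.
(* If two distinct lines had the same image, their inner product would be 5/2 up to sign. *)
- move=> k l E; apply/eqP; apply: contraT => /(dot_vec_offdiag b f).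
  have abs1 m : `|a m| = 1.
    by apply/eqP; rewrite -sqr_norm_eq1 // expr2 a2.
  rewrite dotE E dot_vec_diag normrM normrM !abs1 !mul1r ger0_norm ?divr_ge0 //.
  have lt : 2^-1 < 5 / 2 :> R by lra.
  by move=> H; rewrite H ltxx in lt.
- by move=> k; apply: Zreal_inj; rewrite ZrealM -eE a2 (Zreal_nat 1).
- move=> k l; apply: Zreal_inj; rewrite !ZrealM -!eE.
  by apply: (mulIf half0); rewrite -dot_vec dotE dot_vec mulrA.
Qed.

(** Evaluating [quad_perm] at preimages under [f] shows that [f^-1 * h] preserves [quad]. *)
Lemma isometric_equiv b f c h :
  isometric (config b f) (config c h) -> equiv_params (b, f) (c, h).
Proof.
case/isometric_config => phi [e [phi_inj e2 gE]].
rewrite /equiv_params (factorization_phi phi_inj e2 gE) eqxx /=.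
apply/quad_autsP => i j k l; rewrite !permM.
by rewrite -(quad_perm phi_inj e2 gE) !permKV.
Qed.

End Config.

Local Open Scope fset_scope.

Theorem corollary1p2 (R : realType) :
  exists Phi : 'I_246896 -> {fset {vspace 'rV[R]_18}},
    (forall i, #|` Phi i| = 57%N /\ equiangular (acos (1 / 5)) (Phi i)) /\
    (forall i j, i != j -> ~ isometric (Phi i) (Phi j)).
Proof.
have [x x_inequiv] := inequivalent_params count_params.
exists (fun i => config R (x i).1 (x i).2); split=> [i|i j ij].
  by split; [exact: card_config | exact: equiangular_config].
move/isometric_equiv; rewrite -!surjective_pairing.
exact/negP/x_inequiv.
Qed.
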